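(* Let $\omega$ be a valuation on an Abelian category $\mathcal{M}$, with associated distance $d_\omega$, and let $X,Y$ denote arbitrary objects of $\mathcal{M}$. (1) If $\omega$ is push-out non-expansive and composition sub-additive, then $$d_\omega(X,Y)=\inf\{\omega(f)+\omega(g)\mid X\xrightarrow{f}W\xleftarrow{g}Y\},$$ where the infimum is over all objects $W$ and all morphisms $f\colon X\to W$, $g\colon Y\to W$ in $\mathcal{M}$. (2) If $\omega$ is push-out non-expansive, composition sub-additive, and monotone, then $$d_\omega(X,Y)=\inf\{\omega(f)+\omega(g)\mid [f\ g]\colon X\oplus Y\to W \text{ is an epimorphism}\},$$ where the infimum is over all objects $W$ and all $f\colon X\to W$, $g\colon Y\to W$ such that the induced morphism $[f\ g]\colon X\oplus Y\to W$ is an epimorphism. (3) If $\omega$ is pull-back non-expansive and composition sub-additive, then $$d_\omega(X,Y)=\inf\{\omega(f)+\omega(g)\mid X\xleftarrow{f}W\xrightarrow{g}Y\},$$ where the infimum is over all objects $W$ and all morphisms $f\colon W\to X$, $g\colon W\to Y$. (4) If $\omega$ is pull-back non-expansive, composition sub-additive, and monotone, then $$d_\omega(X,Y)=\inf\{\omega(f)+\omega(g)\mid (f,g)\colon W\to X\oplus Y \text{ is a monomorphism}\},$$ where the infimum is over all objects $W$ and all $f\colon W\to X$, $g\colon W\to Y$ such that the induced morphism $W\to X\oplus Y$ with components $f$ and $g$ is a monomorphism.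
   Context: Let $\mathcal{M}$ be an Abelian category. A valuation on $\mathcal{M}$ is a function $\omega\colon\mathrm{mor}(\mathcal{M})\to[0,\infty]$ such that (1) $\omega(f)=0$ whenever $f$ is an isomorphism, and (2) $\omega(0\colon X\to Y)=\omega(0\colon Y\to X)$ for all objects $X,Y$. The associated distance is $d_\omega(X,Y):=\inf\sum_i\omega(f_i)$, the infimum over all finite zig-zags $X=W_0\xrightarrow{f_1}W_1\xleftarrow{f_2}W_2\xrightarrow{f_3}\cdots\xleftarrow{f_l}W_l=Y$ of arbitrary length in $\mathcal{M}$. Consider commutative squares with top $f\colon X_0\to X_1$, bottom $g\colon Y_0\to Y_1$, and vertical morphisms $X_0\to Y_0$, $X_1\to Y_1$. The valuation $\omega$ is called: - push-out non-expansive if $\omega(f)\ge\omega(g)$ for every such square that is a push-out; - pull-back non-expansive if $\omega(g)\ge\omega(f)$ for every such square that is a pull-back; - composition sub-additive if $\omega(gf)\le\omega(f)+\omega(g)$ for all composable $f\colon X\to Y$, $g\colon Y\to Z$; - monotone if $\omega(gf)\ge\max\{\omega(f),\omega(g)\}$ for all composable $f\colon X\to Y$, $g\colon Y\to Z$ such that $f$ is an epimorphism or $g$ is a monomorphism. *)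

(* Defs.v *)
From mathcomp Require Import all_boot all_order all_algebra.
From mathcomp Require Import classical_sets reals constructive_ereal ereal.

Set Implicit Arguments.
Unset Strict Implicit.
Unset Printing Implicit Defensive.

Local Open Scope classical_set_scope.
Local Open Scope ring_scope.

Record preadditive := Preadditive {
  obj :> Type;
  mor : obj -> obj -> zmodType;
  idmor : forall X, mor X X;
  mcomp : forall X Y Z, mor Y Z -> mor X Y -> mor X Z;
  mcompA : forall X Y Z T (h : mor Z T) (g : mor Y Z) (f : mor X Y),
    mcomp h (mcomp g f) = mcomp (mcomp h g) f;
  mcomp1m : forall X Y (f : mor X Y), mcomp (idmor Y) f = f;
  mcompm1 : forall X Y (f : mor X Y), mcomp f (idmor X) = f;
  mcompDl : forall X Y Z (g1 g2 : mor Y Z) (f : mor X Y),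
    mcomp (g1 + g2) f = mcomp g1 f + mcomp g2 f;
  mcompDr : forall X Y Z (g : mor Y Z) (f1 f2 : mor X Y),
    mcomp g (f1 + f2) = mcomp g f1 + mcomp g f2
}.

Arguments mor {p} X Y.
Arguments idmor {p} X.
Arguments mcomp {p X Y Z} g f.

Notation "g \oc f" := (mcomp g f) (at level 40, left associativity).

Section Morphisms.
Context {C : preadditive}.

Definition is_iso (X Y : C) (f : mor X Y) : Prop :=
  exists g : mor Y X, g \oc f = idmor X /\ f \oc g = idmor Y.

Definition is_mono (X Y : C) (f : mor X Y) : Prop :=
  forall (Z : C) (u v : mor Z X), f \oc u = f \oc v -> u = v.

Definition is_epi (X Y : C) (f : mor X Y) : Prop :=
  forall (Z : C) (u v : mor Y Z), u \oc f = v \oc f -> u = v.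

Definition is_kernel (X Y K : C) (f : mor X Y) (k : mor K X) : Prop :=
  f \oc k = 0 /\
  forall (Z : C) (h : mor Z X), f \oc h = 0 -> exists! u : mor Z K, k \oc u = h.

Definition is_cokernel (X Y Q : C) (f : mor X Y) (q : mor Y Q) : Prop :=
  q \oc f = 0 /\
  forall (Z : C) (h : mor Y Z), h \oc f = 0 -> exists! u : mor Q Z, u \oc q = h.

(* In all squares, f is the top edge, g the bottom edge, a the left edge and
   b the right edge:
         X0 --f--> X1
         |a        |b
         Y0 --g--> Y1                                                       *)
Definition is_pushout (X0 X1 Y0 Y1 : C) (f : mor X0 X1) (g : mor Y0 Y1)
    (a : mor X0 Y0) (b : mor X1 Y1) : Prop :=
  b \oc f = g \oc a /\
  forall (Z : C) (u : mor X1 Z) (v : mor Y0 Z), u \oc f = v \oc a ->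
    exists! w : mor Y1 Z, w \oc b = u /\ w \oc g = v.

Definition is_pullback (X0 X1 Y0 Y1 : C) (f : mor X0 X1) (g : mor Y0 Y1)
    (a : mor X0 Y0) (b : mor X1 Y1) : Prop :=
  b \oc f = g \oc a /\
  forall (Z : C) (u : mor Z X1) (v : mor Z Y0), b \oc u = g \oc v ->
    exists! w : mor Z X0, f \oc w = u /\ a \oc w = v.

End Morphisms.

(* Abelian categories in the sense of Mac Lane: a null object, binary
   biproducts, kernels and cokernels, and normality of monos and epis. *)
Record abelianCat := AbelianCat {
  abcat :> preadditive;
  zero_obj : abcat;
  to_zero_obj : forall (X : abcat) (f : mor X zero_obj), f = 0;
  from_zero_obj : forall (X : abcat) (f : mor zero_obj X), f = 0;
  biprod : abcat -> abcat -> abcat;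
  binj1 : forall X Y, mor X (biprod X Y);
  binj2 : forall X Y, mor Y (biprod X Y);
  bproj1 : forall X Y, mor (biprod X Y) X;
  bproj2 : forall X Y, mor (biprod X Y) Y;
  bproj1_binj1 : forall X Y, bproj1 X Y \oc binj1 X Y = idmor X;
  bproj2_binj2 : forall X Y, bproj2 X Y \oc binj2 X Y = idmor Y;
  bproj1_binj2 : forall X Y, bproj1 X Y \oc binj2 X Y = 0;
  bproj2_binj1 : forall X Y, bproj2 X Y \oc binj1 X Y = 0;
  biprod_id : forall X Y,
    binj1 X Y \oc bproj1 X Y + binj2 X Y \oc bproj2 X Y = idmor (biprod X Y);
  has_kernel : forall (X Y : abcat) (f : mor X Y),
    exists (K : abcat) (k : mor K X), is_kernel f k;
  has_cokernel : forall (X Y : abcat) (f : mor X Y),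
    exists (Q : abcat) (q : mor Y Q), is_cokernel f q;
  mono_normal : forall (X Y : abcat) (m : mor X Y), is_mono m ->
    exists (Z : abcat) (f : mor Y Z), is_kernel f m;
  epi_normal : forall (X Y : abcat) (e : mor X Y), is_epi e ->
    exists (Z : abcat) (f : mor Z X), is_cokernel f e
}.

Arguments binj1 {a} X Y.
Arguments binj2 {a} X Y.
Arguments bproj1 {a} X Y.
Arguments bproj2 {a} X Y.

Definition copair (M : abelianCat) (X Y W : M) (f : mor X W) (g : mor Y W) :
  mor (biprod X Y) W := f \oc bproj1 X Y + g \oc bproj2 X Y.

Definition pair_mor (M : abelianCat) (X Y W : M) (f : mor W X) (g : mor W Y) :
  mor W (biprod X Y) := binj1 X Y \oc f + binj2 X Y \oc g.

Local Open Scope ereal_scope.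

Record valuation (R : realType) (M : abelianCat) := Valuation {
  value : forall X Y : M, mor X Y -> \bar R;
  value_ge0 : forall (X Y : M) (f : mor X Y), 0 <= value f;
  value_iso : forall (X Y : M) (f : mor X Y), is_iso f -> value f = 0;
  value_zero : forall X Y : M,
    value (0%R : mor X Y) = value (0%R : mor Y X)
}.

Arguments value {R M} v {X Y} f.

(* X -> W1 <- W2 -> W3 <- ... <- Y, built from one or more cospans.  Other
   shapes reduce to this one by inserting identities, which have value 0. *)
Inductive zigzag (C : preadditive) (X Y : C) : Type :=
| zz_cospan (W : C) of mor X W & mor Y W
| zz_cons (W V : C) of mor X W & mor V W & zigzag V Y.

Section Valuations.
Context {R : realType} {M : abelianCat}.
Implicit Type w : valuation R M.

Fixpoint zz_cost w (X Y : M) (z : zigzag X Y) : \bar R :=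
  match z with
  | zz_cospan _ f g => value w f + value w g
  | zz_cons _ _ f g z' => value w f + value w g + zz_cost w z'
  end.

Definition vdist w (X Y : M) : \bar R :=
  ereal_inf [set zz_cost w z | z in [set: zigzag X Y]].

Definition pushout_nonexpansive w : Prop :=
  forall (X0 X1 Y0 Y1 : M) (f : mor X0 X1) (g : mor Y0 Y1)
    (a : mor X0 Y0) (b : mor X1 Y1),
    is_pushout f g a b -> value w g <= value w f.

Definition pullback_nonexpansive w : Prop :=
  forall (X0 X1 Y0 Y1 : M) (f : mor X0 X1) (g : mor Y0 Y1)
    (a : mor X0 Y0) (b : mor X1 Y1),
    is_pullback f g a b -> value w f <= value w g.

Definition comp_subadditive w : Prop :=
  forall (X Y Z : M) (f : mor X Y) (g : mor Y Z),
    value w (g \oc f) <= value w f + value w g.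

Definition monotone_val w : Prop :=
  forall (X Y Z : M) (f : mor X Y) (g : mor Y Z), is_epi f \/ is_mono g ->
    maxe (value w f) (value w g) <= value w (g \oc f).

End Valuations.

(* Main.v *)
(* A zig-zag is a chain of cospans.  A cospan sharing a foot with the next one is
   merged with it by pushing out the two legs at that foot: the new legs cost no
   more than the old ones, and sub-additivity absorbs the compositions.  Hence
   every zig-zag is dominated by a single cospan.  In the monotone case, a cospan
   is replaced by the epimorphic part of the image factorization of [f g], whose
   components are cheaper because the remaining factor is a monomorphism.  Spans
   are treated dually; each cospan of a zig-zag first becomes a span by pull-back. *)
Require Import Defs.
From mathcomp Require Import all_boot all_order all_algebra.
From mathcomp Require Import classical_sets reals constructive_ereal ereal.

Set Implicit Arguments.
Unset Strict Implicit.
Unset Printing Implicit Defensive.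

Import Order.TTheory GRing.Theory.

Local Open Scope classical_set_scope.
Local Open Scope ring_scope.

(** * Zero morphisms, cancellation and transposed squares *)

Section Preadditive.
Context {C : preadditive}.
Implicit Types X Y Z : C.

Lemma mcomp0m X Y Z (f : mor X Y) : (0 : mor Y Z) \oc f = 0.
Proof. by apply: (addrI (0 \oc f)); rewrite -mcompDl !addr0. Qed.

Lemma mcompm0 X Y Z (g : mor Y Z) : g \oc (0 : mor X Y) = 0.
Proof. by apply: (addrI (g \oc 0)); rewrite -mcompDr !addr0. Qed.

Lemma mcompNm X Y Z (g : mor Y Z) (f : mor X Y) : (- g) \oc f = - (g \oc f).
Proof. by apply: (addrI (g \oc f)); rewrite -mcompDl !subrr mcomp0m. Qed.

Lemma mcompmN X Y Z (g : mor Y Z) (f : mor X Y) : g \oc (- f) = - (g \oc f).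
Proof. by apply: (addrI (g \oc f)); rewrite -mcompDr !subrr mcompm0. Qed.

Lemma idmor_iso X : is_iso (idmor X).
Proof. by exists (idmor X); rewrite mcomp1m. Qed.

Lemma comp_mono X Y Z (f : mor X Y) (g : mor Y Z) :
  is_mono f -> is_mono g -> is_mono (g \oc f).
Proof. by move=> fm gm T u v; rewrite -!mcompA => /gm /fm. Qed.

Lemma kernel_mono X Y K (f : mor X Y) (k : mor K X) : is_kernel f k -> is_mono k.
Proof.
move=> [fk0 ker] Z u v kuv.
have [|x [_ xuniq]] := ker Z (k \oc v); first by rewrite mcompA fk0 mcomp0m.
by rewrite -(xuniq u kuv) -(xuniq v).
Qed.

Lemma epiP X Y (e : mor X Y) :
  (forall Z (t : mor Y Z), t \oc e = 0 -> t = 0) -> is_epi e.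
Proof.
move=> e0 Z u v uv; apply/eqP; rewrite -subr_eq0; apply/eqP/e0.
by rewrite mcompDl mcompNm uv subrr.
Qed.

(** Non-expansiveness compares only the horizontal edges of a square; transposing makes it available
    for the vertical ones. *)
Lemma pushoutC (X0 X1 Y0 Y1 : C) (f : mor X0 X1) (g : mor Y0 Y1)
    (a : mor X0 Y0) (b : mor X1 Y1) :
  is_pushout f g a b -> is_pushout a b f g.
Proof.
move=> [sq po]; split=> // Z u v uv; have [w [[wb wg] wu]] := po Z v u (esym uv).
by exists w; split=> // w' [? ?]; apply: wu.
Qed.

Lemma pullbackC (X0 X1 Y0 Y1 : C) (f : mor X0 X1) (g : mor Y0 Y1)
    (a : mor X0 Y0) (b : mor X1 Y1) :
  is_pullback f g a b -> is_pullback a b f g.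
Proof.
move=> [sq pb]; split=> // Z u v uv; have [w [[wf wa] wu]] := pb Z v u (esym uv).
by exists w; split=> // w' [? ?]; apply: wu.
Qed.

End Preadditive.

(** * Biproducts, push-outs, pull-backs and images *)

Section Abelian.
Context {M : abelianCat}.
Implicit Types X Y Z W : M.

Lemma copair_binj1 X Y W (f : mor X W) (g : mor Y W) : copair f g \oc binj1 X Y = f.
Proof.
by rewrite mcompDl -!mcompA bproj1_binj1 bproj2_binj1 mcompm1 mcompm0 addr0.
Qed.

Lemma copair_binj2 X Y W (f : mor X W) (g : mor Y W) : copair f g \oc binj2 X Y = g.
Proof.
by rewrite mcompDl -!mcompA bproj1_binj2 bproj2_binj2 mcompm1 mcompm0 add0r.
Qed.

Lemma bproj1_pair X Y W (f : mor W X) (g : mor W Y) : bproj1 X Y \oc pair_mor f g = f.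
Proof.
by rewrite mcompDr !mcompA bproj1_binj1 bproj1_binj2 mcomp1m mcomp0m addr0.
Qed.

Lemma bproj2_pair X Y W (f : mor W X) (g : mor W Y) : bproj2 X Y \oc pair_mor f g = g.
Proof.
by rewrite mcompDr !mcompA bproj2_binj1 bproj2_binj2 mcomp1m mcomp0m add0r.
Qed.

Lemma copair_eta X Y W (h : mor (biprod X Y) W) :
  copair (h \oc binj1 X Y) (h \oc binj2 X Y) = h.
Proof. by rewrite /copair -!mcompA -mcompDr biprod_id mcompm1. Qed.

Lemma pair_mor_eta X Y W (h : mor W (biprod X Y)) :
  pair_mor (bproj1 X Y \oc h) (bproj2 X Y \oc h) = h.
Proof. by rewrite /pair_mor !mcompA -mcompDl biprod_id mcomp1m. Qed.

Lemma copair_pair X Y Z W (u : mor X W) (v : mor Y W) (f : mor Z X) (g : mor Z Y) :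
  copair u v \oc pair_mor f g = u \oc f + v \oc g.
Proof. by rewrite mcompDr !mcompA copair_binj1 copair_binj2. Qed.

(** A cocone [u], [v] is a map out of [biprod X1 Y0] killing the morphism with components [f] and
    [- a], so the cokernel of the latter is the universal one. *)
Lemma has_pushout (X0 X1 Y0 : M) (f : mor X0 X1) (a : mor X0 Y0) :
  exists (Y1 : M) (g : mor Y0 Y1) (b : mor X1 Y1), is_pushout f g a b.
Proof.
have [Q [q [q0 cok]]] := has_cokernel (pair_mor f (- a)).
exists Q, (q \oc binj2 X1 Y0), (q \oc binj1 X1 Y0); split.
  move: q0; rewrite -{1}(copair_eta q) copair_pair mcompmN.
  by move=> /eqP; rewrite subr_eq0 => /eqP.
move=> Z u v uv; have [|w [wq wuniq]] := cok Z (copair u v).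
  by rewrite copair_pair mcompmN uv subrr.
exists w; split; first by rewrite !mcompA wq copair_binj1 copair_binj2.
by move=> w' [wb wg]; apply: wuniq; rewrite -wb -wg !mcompA copair_eta.
Qed.

Lemma has_pullback (X1 Y0 Y1 : M) (b : mor X1 Y1) (g : mor Y0 Y1) :
  exists (X0 : M) (f : mor X0 X1) (a : mor X0 Y0), is_pullback f g a b.
Proof.
have [K [k [k0 ker]]] := has_kernel (copair b (- g)).
exists K, (bproj1 X1 Y0 \oc k), (bproj2 X1 Y0 \oc k); split.
  move: k0; rewrite -{1}(pair_mor_eta k) copair_pair mcompNm.
  by move=> /eqP; rewrite subr_eq0 => /eqP.
move=> Z u v uv; have [|w [kw wuniq]] := ker Z (pair_mor u v).
  by rewrite copair_pair mcompNm uv subrr.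
exists w; split; first by rewrite -!mcompA kw bproj1_pair bproj2_pair.
by move=> w' [wf wa]; apply: wuniq; rewrite -wf -wa -!mcompA pair_mor_eta.
Qed.

(** The image is the kernel [m] of the cokernel [q] of [h]. If [t] kills [e], then [h] already
    factors through [m] restricted to the kernel of [t]; normality of this subobject forces it to be
    all of [m], hence [t = 0]. *)
Lemma image_factorization X Y (h : mor X Y) :
  exists (I : M) (m : mor I Y) (e : mor X I), [/\ is_mono m, is_epi e & h = m \oc e].
Proof.
have [Q [q [qh0 cok]]] := has_cokernel h.
have [I [m ker_m]] := has_kernel q.
have m_mono := kernel_mono ker_m.
have [qm0 /(_ _ _ qh0) [e [me _]]] := ker_m.
exists I, m, e; split=> //; apply: epiP => Z t te0.
have [K [k ker_k]] := has_kernel t.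
have [tk0 /(_ _ _ te0) [e' [ke' _]]] := ker_k.
(* The subobject [m k] of [Y] contains the image [m] since [h] factors through it. *)
have [T [c [cmk0 mk_univ]]] := mono_normal (comp_mono (kernel_mono ker_k) m_mono).
have ch0 : c \oc h = 0.
  by rewrite -me -ke' (mcompA m) mcompA cmk0 mcomp0m.
(* Since [c] kills [h], it factors through [q], hence kills [m]; so [m] lifts along the kernel of
   [c]. *)
have [c' [c'q _]] := cok _ _ ch0.
have [|s [mks _]] := mk_univ _ m; first by rewrite -c'q -mcompA qm0 mcompm0.
have ks1 : k \oc s = idmor I by apply: m_mono; rewrite mcompA mks mcompm1.
by rewrite -(mcompm1 t) -ks1 mcompA tk0 mcomp0m.
Qed.

End Abelian.

Local Open Scope ereal_scope.

Lemma ereal_inf_eq (R : realType) (A B : set (\bar R)) :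
  (forall x, A x -> exists2 y, B y & y <= x) ->
  (forall y, B y -> exists2 x, A x & x <= y) ->
  ereal_inf A = ereal_inf B.
Proof.
move=> AB BA; apply/eqP; rewrite eq_le; apply/andP.
by split; apply: le_ereal_inf_tmp => x ?; apply: ge_ereal_inf; [exact: BA|exact: AB].
Qed.

(** * Merging zig-zags into one cospan or span *)

Section Distance.
Context {R : realType} {M : abelianCat} (w : valuation R M).
Implicit Types X Y V W : M.

Lemma value_idmor X : value w (idmor X) = 0.
Proof. exact/value_iso/idmor_iso. Qed.

Lemma cospan_comp X Y V W U (f : mor X W) (g : mor V W) (f' : mor V U) (g' : mor Y U) :
  pushout_nonexpansive w -> comp_subadditive w ->
  exists P (p : mor X P) (q : mor Y P),
    value w p + value w q <= value w f + value w g + (value w f' + value w g').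
Proof.
move=> po sub; have [P [a [b sq]]] := has_pushout g f'.
exists P, (b \oc f), (a \oc g').
(* In the square [a] lies opposite [g] and [b] opposite [f'], so each new leg is charged to the
   inner leg of the other cospan. *)
have le_a : value w a <= value w g := po _ _ _ _ _ _ _ _ sq.
have le_b : value w b <= value w f' := po _ _ _ _ _ _ _ _ (pushoutC sq).
apply: le_trans (leeD (sub _ _ _ _ _) (sub _ _ _ _ _)) _.
by rewrite [value w g' + _]addeC addeACA !leeD.
Qed.

Lemma span_comp X Y V W U (f : mor W X) (g : mor W V) (f' : mor U V) (g' : mor U Y) :
  pullback_nonexpansive w -> comp_subadditive w ->
  exists P (p : mor P X) (q : mor P Y),
    value w p + value w q <= value w f + value w g + (value w f' + value w g').
Proof.
move=> pb sub; have [P [a [b sq]]] := has_pullback f' g.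
exists P, (f \oc b), (g' \oc a).
have le_a : value w a <= value w g := pb _ _ _ _ _ _ _ _ sq.
have le_b : value w b <= value w f' := pb _ _ _ _ _ _ _ _ (pullbackC sq).
apply: le_trans (leeD (sub _ _ _ _ _) (sub _ _ _ _ _)) _.
by rewrite [value w b + _]addeC addeACA !leeD.
Qed.

Lemma zigzag_ge_cospan X Y (z : zigzag X Y) :
  pushout_nonexpansive w -> comp_subadditive w ->
  exists W (f : mor X W) (g : mor Y W), value w f + value w g <= zz_cost w z.
Proof.
move=> po sub; elim: z => [{}X {}Y W f g|{}X {}Y W V f g z [U [f' [g' le_z]]]] /=.
  by exists W, f, g.
have [P [p [q le_pq]]] := cospan_comp f g f' g' po sub.
by exists P, p, q; apply: le_trans le_pq _; rewrite leeD.
Qed.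

Lemma cospan_ge_span X Y W (f : mor X W) (g : mor Y W) : pullback_nonexpansive w ->
  exists P (p : mor P X) (q : mor P Y), value w p + value w q <= value w f + value w g.
Proof.
move=> pb; have [P [q [p sq]]] := has_pullback g f.
(* The costs cross over: [q] lies opposite [f], and [p] opposite [g]. *)
exists P, p, q; rewrite addeC.
exact: leeD (pb _ _ _ _ _ _ _ _ sq) (pb _ _ _ _ _ _ _ _ (pullbackC sq)).
Qed.

Lemma zigzag_ge_span X Y (z : zigzag X Y) :
  pullback_nonexpansive w -> comp_subadditive w ->
  exists W (f : mor W X) (g : mor W Y), value w f + value w g <= zz_cost w z.
Proof.
move=> pb sub; elim: z => [{}X {}Y W f g|{}X {}Y W V f g z [U [f' [g' le_z]]]] /=.
  exact: cospan_ge_span.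
have [P [p [q le_pq]]] := cospan_ge_span f g pb.
have [Q [p' [q' le_pq']]] := span_comp p q f' g' pb sub.
by exists Q, p', q'; apply: le_trans le_pq' _; rewrite leeD.
Qed.

Lemma cospan_ge_epi X Y W (f : mor X W) (g : mor Y W) : monotone_val w ->
  exists W' (f' : mor X W') (g' : mor Y W'),
    is_epi (copair f' g') /\ value w f' + value w g' <= value w f + value w g.
Proof.
move=> mon; have [I [m [e [m_mono e_epi fg]]]] := image_factorization (copair f g).
exists I, (e \oc binj1 X Y), (e \oc binj2 X Y); split; first by rewrite copair_eta.
(* Both legs become restrictions of [copair f g]; the first occurrence of [g] is by then inside that
   morphism and must stay. *)
rewrite -(copair_binj1 f g) -{2}(copair_binj2 f g) fg -!mcompA.
have le_m V (h : mor V I) : value w h <= value w (m \oc h).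
  by apply: le_trans (mon _ _ _ h m (or_intror m_mono)); rewrite le_max lexx.
exact: leeD.
Qed.

Lemma span_ge_mono X Y W (f : mor W X) (g : mor W Y) : monotone_val w ->
  exists W' (f' : mor W' X) (g' : mor W' Y),
    is_mono (pair_mor f' g') /\ value w f' + value w g' <= value w f + value w g.
Proof.
move=> mon; have [I [m [e [m_mono e_epi fg]]]] := image_factorization (pair_mor f g).
exists I, (bproj1 X Y \oc m), (bproj2 X Y \oc m); split; first by rewrite pair_mor_eta.
rewrite -(bproj1_pair f g) -{2}(bproj2_pair f g) fg !mcompA.
(* Now the monomorphic factor is kept, and the discarded factor [e] is precomposed, so the
   epimorphism case of monotonicity applies. *)
have le_e V (h : mor I V) : value w h <= value w (h \oc e).
  by apply: le_trans (mon _ _ _ e h (or_introl e_epi)); rewrite le_max lexx orbT.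
exact: leeD.
Qed.

(** Zig-zags are chains of cospans, so a span is padded with a free identity at each end. *)
Lemma span_zigzag X Y W (f : mor W X) (g : mor W Y) :
  exists z : zigzag X Y, zz_cost w z = value w f + value w g.
Proof.
exists (zz_cons (idmor X) f (zz_cospan g (idmor Y))).
by rewrite /= !value_idmor add0e adde0.
Qed.

End Distance.

Theorem theorem2p5 (R : realType) (M : abelianCat) (w : valuation R M) :
  [/\ (pushout_nonexpansive w -> comp_subadditive w ->
        forall X Y : M,
        vdist w X Y =
        ereal_inf [set s : \bar R | exists (W : M) (f : mor X W) (g : mor Y W),
                                       s = value w f + value w g]),
      (pushout_nonexpansive w -> comp_subadditive w -> monotone_val w ->
        forall X Y : M,
        vdist w X Y =
        ereal_inf [set s : \bar R | exists (W : M) (f : mor X W) (g : mor Y W),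
                                       is_epi (copair f g) /\
                                       s = value w f + value w g]),
      (pullback_nonexpansive w -> comp_subadditive w ->
        forall X Y : M,
        vdist w X Y =
        ereal_inf [set s : \bar R | exists (W : M) (f : mor W X) (g : mor W Y),
                                       s = value w f + value w g])
    & (pullback_nonexpansive w -> comp_subadditive w -> monotone_val w ->
        forall X Y : M,
        vdist w X Y =
        ereal_inf [set s : \bar R | exists (W : M) (f : mor W X) (g : mor W Y),
                                       is_mono (pair_mor f g) /\
                                       s = value w f + value w g])].
Proof.
(* Each equality yields two goals: a zig-zag is dominated by an admissible pair, and an admissible
   pair is realised by a zig-zag of the same cost. *)
split=> [po sub X Y|po sub mon X Y|pb sub X Y|pb sub mon X Y]; apply: ereal_inf_eq.
- move=> _ [z _ <-]; have [W [f [g le_z]]] := zigzag_ge_cospan z po sub.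
  by exists (value w f + value w g) => //; exists W, f, g.
- by move=> _ [W [f [g ->]]]; exists (zz_cost w (zz_cospan f g)) => //; exists (zz_cospan f g).
- move=> _ [z _ <-]; have [W [f [g le_z]]] := zigzag_ge_cospan z po sub.
  have [W' [f' [g' [epi le_fg]]]] := cospan_ge_epi f g mon.
  exists (value w f' + value w g'); first by exists W', f', g'.
  exact: le_trans le_z.
- by move=> _ [W [f [g [_ ->]]]]; exists (zz_cost w (zz_cospan f g)) => //; exists (zz_cospan f g).
- move=> _ [z _ <-]; have [W [f [g le_z]]] := zigzag_ge_span z pb sub.
  by exists (value w f + value w g) => //; exists W, f, g.
- move=> _ [W [f [g ->]]]; have [z <-] := span_zigzag w f g.
  by exists (zz_cost w z) => //; exists z.
- move=> _ [z _ <-]; have [W [f [g le_z]]] := zigzag_ge_span z pb sub.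
  have [W' [f' [g' [mono le_fg]]]] := span_ge_mono f g mon.
  exists (value w f' + value w g'); first by exists W', f', g'.
  exact: le_trans le_z.
- move=> _ [W [f [g [_ ->]]]]; have [z <-] := span_zigzag w f g.
  by exists (zz_cost w z) => //; exists z.
Qed.
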